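(* There exists a universal constant $\alpha_0>0$ such that, for every $\alpha\in(0,\alpha_0)$, any learner that, uniformly over regular product distributions $D=D_B\times D_S$ on $[0,h]^2$, outputs with probability at least $2/3$ a mechanism $M$ that is BIC, IIR and ex-ante WBB under $D$ and achieves a $(1-\alpha)$-approximation to $\mathrm{SB}(D)$, i.e. $\mathrm{GFT}(M;D)\ge(1-\alpha)\,\mathrm{SB}(D)$, requires \[ m=\Omega\!\left(\frac{h}{\mathrm{SB}(D)}\,\frac1{\alpha^2}\right) \] samples from each marginal in the worst case.
   Context: **Bilateral trade.** A buyer has private value $b\sim D_B$ and a seller has private cost $s\sim D_S$, independently; $D=D_B\times D_S$ is supported on $[0,h]^2$, $h>0$. A direct mechanism $M=(q,x_B,x_S)$ consists of a trade probability $q(b,s)\in[0,1]$, a payment $x_B(b,s)$ made by the buyer and a payment $x_S(b,s)$ made to the seller. Define $\mathrm{GFT}(M;D)=\mathbb E_D[q(b,s)(b-s)]$ and $\mathrm{Rev}(M;D)=\mathbb E_D[x_B(b,s)-x_S(b,s)]$. Under $D$, $M$ is BIC (Bayesian incentive compatible) if truthful reporting maximizes interim expected utility for each type (buyer: $\mathbb E_{s\sim D_S}[b\,q(b',s)-x_B(b',s)]$ is maximized at $b'=b$; seller: $\mathbb E_{b\sim D_B}[x_S(b,s')-s\,q(b,s')]$ is maximized at $s'=s$); IIR (interim individually rational) if these truthful interim utilities are $\ge0$; ex-ante WBB (weakly budget balanced) if $\mathrm{Rev}(M;D)\ge0$. $M$ is feasible on $D$ if it is BIC, IIR and ex-ante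 WBB under $D$, and $\mathrm{SB}(D)=\sup\{\mathrm{GFT}(M;D): M \text{ feasible on } D\}$. **Regularity.** Marginals have cdfs $F_B,F_S$ and densities $f_B,f_S$ on the interiors of their supports. $D$ is regular if $\phi_B(b)=b-\frac{1-F_B(b)}{f_B(b)}$ and $\phi_S(s)=s+\frac{F_S(s)}{f_S(s)}$ are nondecreasing. **Learner.** A (possibly randomized) learner receives $m$ independent samples from $D_B$ and $m$ independent samples from $D_S$ and outputs a mechanism. The $\Omega(\cdot)$ hides a universal constant, and ''in the worst case'' refers to the unknown instance $D$. *)

(* Defs.v *)
From HB Require Import structures.
From mathcomp Require Import all_boot all_order all_algebra.
From mathcomp Require Import all_classical all_reals all_analysis.
Set Implicit Arguments.
Unset Strict Implicit.
Unset Printing Implicit Defensive.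
Import Order.TTheory GRing.Theory Num.Theory.
Import numFieldNormedType.Exports.
Local Open Scope classical_set_scope.
Local Open Scope ring_scope.

Section marginals.
Context {R : realType}.
Implicit Types (mu : probability R R) (f : R -> R) (lo hi x : R).

Definition cdf_of mu x : R := fine (mu `]-oo, x]%classic).

(* The support is the interval [lo, hi]: mu gives it full mass and f is
   positive inside it.  Only the restriction of mu to the open interval is
   required to have a density, so atoms at lo and hi are permitted. *)
Definition density_on_interior mu lo hi f : Prop :=
  [/\ mu `[lo, hi]%classic = 1%E,
      measurable_fun `]lo, hi[%classic f,
      forall x, lo < x < hi -> 0 < f x
    & forall A, measurable A -> A `<=` `]lo, hi[%classic ->
        mu A = (\int[lebesgue_measure]_(x in A) (f x)%:E)%E].

Definition buyer_virtual_value mu f x : R := x - (1 - cdf_of mu x) / f x.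

Definition seller_virtual_cost mu f x : R := x + cdf_of mu x / f x.

(* Densities are determined only up to null sets, hence the existential. *)
Definition regular_marginal (h : R) (phi : probability R R -> (R -> R) -> R -> R)
    mu : Prop :=
  exists lo hi f,
    [/\ 0 <= lo, lo < hi, hi <= h, density_on_interior mu lo hi f
      & forall x y, lo < x -> x <= y -> y < hi -> phi mu f x <= phi mu f y].

Definition regular_instance (h : R) (DB DS : probability R R) : Prop :=
  regular_marginal h buyer_virtual_value DB /\
  regular_marginal h seller_virtual_cost DS.

End marginals.

(* Reports are pairs (b, s).  The functions are total on R * R; only their
   values on [0, h]^2 matter below. *)
Record mechanism (R : realType) := Mechanism {
  trade : R * R -> R;
  buyer_pays : R * R -> R;
  seller_gets : R * R -> R;
  trade_measurable : measurable_fun setT trade;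
  buyer_pays_measurable : measurable_fun setT buyer_pays;
  seller_gets_measurable : measurable_fun setT seller_gets;
  trade_prob : forall r, 0 <= trade r <= 1 }.

Section bilateral_trade.
Context {R : realType}.
Variable h : R.
Variables DB DS : probability R R.
Implicit Type M : mechanism R.

Definition GFT M : R := \int[(DB \x DS)%E]_x (trade M x * (x.1 - x.2)).

Definition Rev M : R := \int[(DB \x DS)%E]_x (buyer_pays M x - seller_gets M x).

(* All expected payments, interim and ex ante, are finite; otherwise the real
   integrals in the definitions below would carry no meaning. *)
Definition payments_integrable M : Prop :=
  [/\ forall b, 0 <= b <= h ->
        DS.-integrable setT (fun s => (buyer_pays M (b, s))%:E),
      forall s, 0 <= s <= h ->
        DB.-integrable setT (fun b => (seller_gets M (b, s))%:E),
      (DB \x DS)%E.-integrable setT (fun x => (buyer_pays M x)%:E)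
    & (DB \x DS)%E.-integrable setT (fun x => (seller_gets M x)%:E)].

(* Interim expected utility of true type b (resp. s) reporting b' (resp. s'). *)
Definition buyer_utility M (b b' : R) : R :=
  \int[DS]_s (b * trade M (b', s) - buyer_pays M (b', s)).

Definition seller_utility M (s s' : R) : R :=
  \int[DB]_b (seller_gets M (b, s') - s * trade M (b, s')).

Definition BIC M : Prop :=
  (forall b b', 0 <= b <= h -> 0 <= b' <= h ->
     buyer_utility M b b' <= buyer_utility M b b) /\
  (forall s s', 0 <= s <= h -> 0 <= s' <= h ->
     seller_utility M s s' <= seller_utility M s s).

Definition IIR M : Prop :=
  (forall b, 0 <= b <= h -> 0 <= buyer_utility M b b) /\
  (forall s, 0 <= s <= h -> 0 <= seller_utility M s s).

Definition WBB M : Prop := 0 <= Rev M.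

Definition feasible M : Prop :=
  [/\ payments_integrable M, BIC M, IIR M & WBB M].

Definition SB : R := sup [set GFT M | M in feasible].

End bilateral_trade.

Section samples.
Context {R : realType}.

Definition cons_tuple n (x : R * n.-tuple R) : n.+1.-tuple R :=
  [the n.+1.-tuple R of x.1 :: x.2].

Lemma measurable_cons_tuple n : measurable_fun setT (@cons_tuple n).
Proof. exact: measurable_cons. Qed.

HB.instance Definition _ n := isMeasurableFun.Build _ _ _ _
  (@cons_tuple n) (@measurable_cons_tuple n).

(* The n-fold product of mu: the law of n independent samples. *)
Fixpoint iid (mu : probability R R) n : probability (n.-tuple R) R :=
  if n is k.+1 then distribution (mu \x iid mu k)%E (@cons_tuple k)
  else dirac ([tuple] : 0.-tuple R).

End samples.

(* A learner with m samples per marginal, randomized through a seed in S. *)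
Definition learner (R : realType) (S : Type) (m : nat) :=
  S -> m.-tuple R -> m.-tuple R -> mechanism R.

(* Mechanisms carry no sigma-algebra, so the set of successful outcomes need
   not be measurable: its inner probability is required to be at least 2/3. *)
Definition learns (R : realType) d (S : measurableType d) (P : probability S R)
    (m : nat) (L : learner R S m) (h alpha : R) (DB DS : probability R R) :=
  exists E : set (S * (m.-tuple R * m.-tuple R)),
    [/\ measurable E,
        ((2 / 3)%:E <= (P \x (iid DB m \x iid DS m)) E)%E
      & forall w, E w ->
          let M := L w.1 w.2.1 w.2.2 in
          feasible h DB DS M /\ (1 - alpha) * SB h DB DS <= GFT DB DS M].

(* Main.v *)
(* Two instances share the seller, whose cost is 0 or 3h/4 with probability about
   1/2 each; the buyer's value is h with probability p and b = v/16 otherwise,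
   with p = p0 = 2b/h or p = p1 = p0 (1 + 100 alpha).  A uniform part of mass
   alpha b / h between the atoms supplies the densities.  The mechanism trading
   at all efficient pairs of atoms runs exactly balanced at p0 and a deficit of
   order alpha b at p1, so a mechanism feasible at p1 gives up trade worth more
   than alpha SB at p0: no output is successful on both instances.  On the other
   hand (int F dmu1)^2 <= C int F^2 dmu0 with C - 1 <= 2 p0 (100 alpha)^2, an
   inequality that tensorizes to m samples with constant C^m, and events of
   probability at least 2/3 under mu1 and at most 1/3 under mu0 force
   C^m >= 4/3. *)
From HB Require Import structures.
Require Import Defs.
From mathcomp Require Import all_boot all_order all_algebra.
From mathcomp Require Import all_classical all_reals all_analysis.
From mathcomp Require Import measurable_realfun ring lra.
Set Implicit Arguments.
Unset Strict Implicit.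
Unset Printing Implicit Defensive.
Import Order.TTheory GRing.Theory Num.Theory.
Import numFieldNormedType.Exports.
Local Open Scope classical_set_scope.
Local Open Scope ring_scope.

(** * Second-moment domination *)

Section second_moment_domination.
Context {R : realType}.
Local Open Scope ereal_scope.

(** When [mu] has a density with respect to [nu], the least such [C] is the second moment of that
    density under [nu], that is, one plus the chi-square divergence. Testing against functions
    avoids Radon-Nikodym derivatives and passes easily to products and image laws. *)
Definition dominates2 d (T : measurableType d) (C : R)
    (mu nu : probability T R) : Prop :=
  forall F : T -> \bar R, measurable_fun setT F -> (forall x, 0 <= F x) ->
    (\int[mu]_x F x) * (\int[mu]_x F x) <= C%:E * \int[nu]_x (F x * F x).

Lemma mul2e_le (x t : \bar R) : 0 <= x -> (0 <= t) -> t \is a fin_num ->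
  2%:E * t * x <= x * x + t * t.
Proof.
case: x => [x| |] // x0; case: t => [t| |] // t0 _.
  by rewrite -!EFinM -EFinD lee_fin; have := sqr_ge0 (x - t)%R; rewrite expr2; lra.
by rewrite mulyy addye// leey.
Qed.

Lemma dominates2_refl d (T : measurableType d) (mu : probability T R) :
  dominates2 1 mu mu.
Proof.
move=> F mF F0; rewrite mul1e.
have mFF : measurable_fun setT (fun x => F x * F x) by exact: emeasurable_funM.
have FF0 x : 0 <= F x * F x by rewrite mule_ge0.
set t := \int[mu]_x F x; set s := \int[mu]_x (F x * F x).
have t0 : 0 <= t by exact: integral_ge0.
(* This integrates [(F - u)^2 >= 0]. Taking [u] to be the mean settles the case of a finite mean;
   [u = 1] shows that an infinite mean forces an infinite second moment. *)
have key (u : R) : (0 <= u)%R -> 2%:E * u%:E * t <= s + u%:E * u%:E.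
  move=> u0.
  have -> : u%:E * u%:E = \int[mu]_x (cst (u * u)%:E x).
    by rewrite integral_cst//= probability_setT mule1 EFinM.
  rewrite -ge0_integralD//; last by move=> x _; rewrite lee_fin mulr_ge0.
  rewrite -EFinM -ge0_integralZl//; last by rewrite lee_fin mulr_ge0.
  apply: ge0_le_integral => //.
  - by move=> x _; rewrite mule_ge0// lee_fin mulr_ge0.
  - exact: measurable_funeM.
  - exact: emeasurable_funD.
  - by move=> x _; rewrite !EFinM mul2e_le// lee_fin.
have s0 : 0 <= s by exact: integral_ge0.
case: t t0 key => [r| |] // t0 key.
- move: s0 (key r t0) => {key}; case: s => [s _|_ _|] //; last exact: leey.
  by rewrite -!EFinM -EFinD !lee_fin; lra.
move: s0 (key 1%R ler01) => {key}; case: s => [s _|_ _|] //.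
by rewrite !mule1 gt0_muley ?lte_fin.
Qed.

(** By Tonelli the first domination applies to the partial integral of [F] over [mu2], and the
    second one bounds the square of that partial integral for each fixed [x]. *)
Lemma dominates2_prod d1 d2 (T1 : measurableType d1) (T2 : measurableType d2)
    (C1 C2 : R) (mu1 nu1 : probability T1 R) (mu2 nu2 : probability T2 R) :
  (0 <= C1)%R -> (0 <= C2)%R ->
  dominates2 C1 mu1 nu1 -> dominates2 C2 mu2 nu2 ->
  dominates2 (C1 * C2) (mu1 \x mu2) (nu1 \x nu2).
Proof.
move=> C10 C20 dom1 dom2 F mF F0.
have mFF : measurable_fun setT (fun x => F x * F x) by exact: emeasurable_funM.
have FF0 x : 0 <= F x * F x by rewrite mule_ge0.
rewrite (fubini_tonelli1 _ mF F0) (fubini_tonelli1 _ mFF FF0).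
have mI : measurable_fun setT (fun x => \int[mu2]_y F (x, y)).
  exact: measurable_fun_fubini_tonelli_F.
have mJ : measurable_fun setT (fun x => \int[nu2]_y (F (x, y) * F (x, y))).
  exact: (measurable_fun_fubini_tonelli_F _ mFF).
apply: (le_trans (dom1 _ mI (fun x => integral_ge0 _ (fun y _ => F0 _)))).
rewrite EFinM -muleA lee_wpmul2l ?lee_fin//.
rewrite -ge0_integralZl//; last by move=> x _; exact: integral_ge0.
apply: ge0_le_integral => //.
- by move=> x _; rewrite mule_ge0// integral_ge0.
- exact: emeasurable_funM.
- exact: measurable_funeM.
- by move=> x _; apply: dom2 => //; exact: measurableT_comp.
Qed.

Lemma dominates2_distribution d d' (T : measurableType d)
    (T' : measurableType d') (C : R) (mu nu : probability T R)
    (X : {mfun T >-> T'}) :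
  dominates2 C mu nu -> dominates2 C (distribution mu X) (distribution nu X).
Proof.
move=> dom F mF F0.
have mFF : measurable_fun setT (fun x => F x * F x) by exact: emeasurable_funM.
have FF0 x : 0 <= F x * F x by rewrite mule_ge0.
rewrite !ge0_integral_distribution//.
by apply: (dom (F \o X)) => [|x] //=; exact: measurableT_comp.
Qed.

Lemma dominates2_iid (C : R) (mu nu : probability R R) n :
  (0 <= C)%R -> dominates2 C mu nu ->
  dominates2 (C ^+ n) (iid mu n) (iid nu n).
Proof.
move=> C0 dom; elim: n => [|n IHn] /=; first exact: dominates2_refl.
rewrite exprS; apply: dominates2_distribution.
by apply: dominates2_prod => //; exact: exprn_ge0.
Qed.

Lemma dominates2_event d (T : measurableType d) (C : R)
    (mu nu : probability T R) (E : set T) :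
  measurable E -> dominates2 C mu nu -> mu E * mu E <= C%:E * nu E.
Proof.
move=> mE dom.
have mI : measurable_fun setT (fun x => (\1_E x : R)%:E).
  exact/measurable_EFinP.
have := dom _ mI (fun x => _).
have -> : (fun x => (\1_E x : R)%:E * (\1_E x)%:E) = (fun x => (\1_E x)%:E).
  by apply/funext => x; rewrite -EFinM indicE; case: (_ \in _); rewrite ?mulr1 ?mulr0.
rewrite !integral_indic// setIT; apply.
by move=> x; rewrite lee_fin.
Qed.

End second_moment_domination.

(** * Two-atom marginals *)

Section uniform_law.
Context {R : realType} (lo hi : R) (lohi : lo < hi).

(* [uniform_prob] lives on [measurableTypeR R], whose display differs from that
   of [R]; the sigma-algebras are convertible. *)
Definition uniform_law : set R -> \bar R := uniform_prob lohi.

HB.instance Definition _ := isMeasure.Build _ R R uniform_law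
  (measure0 (uniform_prob lohi)) (measure_ge0 (uniform_prob lohi))
  (@measure_semi_sigma_additive _ _ _ (uniform_prob lohi)).

HB.instance Definition _ := Measure_isProbability.Build _ R R uniform_law
  (probability_setT (uniform_prob lohi)).

End uniform_law.

Section two_point_laws.
Context {R : realType}.

(** Integrals of nonnegative functions determine the law, and this form serves set measures, real
    integrals and second moments alike. The masses are [a] at [lo], [c] at [hi], and [e] spread
    uniformly in between. *)
Definition two_point_law (lo hi : R) (lohi : lo < hi) (a c e : R)
    (mu : probability R R) : Prop :=
  [/\ 0 < a, 0 < c, 0 < e, a + c + e = 1 &
    forall F : R -> \bar R, measurable_fun setT F -> (forall x, (0 <= F x)%E) ->
      (\int[mu]_x F x =
        a%:E * F lo + (c%:E * F hi + e%:E * \int[uniform_law lohi]_x F x))%E].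

Lemma two_point_law_exists (lo hi : R) (lohi : lo < hi) (a c e : R) :
  0 < a -> 0 < c -> 0 < e -> a + c + e = 1 ->
  exists mu : probability R R, two_point_law lohi a c e mu.
Proof.
move=> a0 c0 e0 ace.
pose m : {measure set R -> \bar R} :=
  measure_add (mscale (NngNum (ltW a0)) (@dirac _ R lo R))
    (measure_add (mscale (NngNum (ltW c0)) (@dirac _ R hi R))
      (mscale (NngNum (ltW e0)) (uniform_law lohi))).
have intm (F : R -> \bar R) : measurable_fun setT F ->
    (forall x, (0 <= F x)%E) ->
    (\int[m]_x F x =
      a%:E * F lo + (c%:E * F hi + e%:E * \int[uniform_law lohi]_x F x))%E.
  move=> mF F0; rewrite /m !ge0_integral_measure_add// !ge0_integral_mscale//=.
  by rewrite !integral_dirac// !diracE !in_setT !mul1e.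
have m1 : m setT = 1%E.
  have := intm (cst 1%E) (measurable_cst _) (fun _ => lee01).
  rewrite !integral_cst//= !probability_setT !mule1 mul1e => ->.
  by rewrite -!EFinD addrA ace.
(* The total mass of [m] is 1 by [m1], so normalizing keeps the measure and supplies the type of
   probabilities. *)
exists (mnormalize m (dirac lo)); split => // F mF F0.
rewrite -intm//; apply: eq_measure_integral => A mA _.
by rewrite /= /mnormalize m1 /= onee_eq0/= invr1 mule1.
Qed.

Context (lo hi : R) (lohi : lo < hi) (a c e : R) (mu : probability R R).
Context (law : two_point_law lohi a c e mu).
Local Notation U := (uniform_law lohi).

Lemma two_point_measure (A : set R) : measurable A ->
  (mu A = a%:E * (\1_A lo : R)%:E + (c%:E * (\1_A hi : R)%:E + e%:E * U A))%E.
Proof.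
move=> mA; have [_ _ _ _ lawE] := law.
have mI : measurable_fun setT (fun x => (\1_A x : R)%:E).
  exact/measurable_EFinP.
have := lawE _ mI (fun x => _); rewrite !integral_indic// !setIT; apply.
by move=> x; rewrite lee_fin.
Qed.

Lemma uniform_law_oo : U `]lo, hi[ = 1%E.
Proof.
rewrite /uniform_law /uniform_prob integral_uniform_pdf.
rewrite (_ : `]lo, hi[ `&` `[lo, hi] = `]lo, hi[)%classic; last first.
  by apply/setIidl; apply: subset_itvW.
rewrite (eq_integral (fun=> ((hi - lo)^-1)%:E)); last first.
  move=> x; rewrite inE/= in_itv/= => /andP[lx xh].
  by rewrite /uniform_pdf (ltW lx) (ltW xh).
rewrite integral_cst//= lebesgue_measure_itv/= lte_fin lohi.
by rewrite -EFinD -EFinM mulVf// gt_eqF// subr_gt0.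
Qed.

Lemma uniform_law_oo0 : U (~` `]lo, hi[%classic) = 0%E.
Proof. by rewrite probability_setC// [X in (_ - X)%E]uniform_law_oo subee. Qed.

Lemma two_point_density :
  density_on_interior mu lo hi (fun=> e / (hi - lo)).
Proof.
have [a0 c0 e0 ace _] := law; split => //.
- rewrite two_point_measure// !indicE !mem_set/= ?in_itv/= ?lexx ?(ltW lohi)//.
  have -> : U `[lo, hi]%classic = 1%E.
    by rewrite /uniform_law /uniform_prob integral_uniform_pdf1.
  by rewrite !mule1 -!EFinD addrA ace.
- by move=> x _; rewrite divr_gt0// subr_gt0.
- move=> A mA Aoo; rewrite two_point_measure// !indicE.
  rewrite !memNset; last 2 first.
    by move/Aoo; rewrite /= in_itv/= ltxx andbF.
    by move/Aoo; rewrite /= in_itv/= ltxx.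
  rewrite !mule0 !add0e /uniform_law /uniform_prob integral_cst//.
  rewrite (eq_integral (fun=> ((hi - lo)^-1)%:E)); last first.
    move=> x; rewrite inE => /Aoo; rewrite /= in_itv/= => /andP[lx xh].
    by rewrite /uniform_pdf (ltW lx) (ltW xh).
  by rewrite integral_cst// EFinM muleA.
Qed.

Lemma cdf_of_nondecreasing x y : x <= y -> cdf_of mu x <= cdf_of mu y.
Proof.
move=> xy; rewrite /cdf_of fine_le ?fin_num_measure//.
by apply: le_measure; rewrite ?inE//; apply: subset_itvl; rewrite bnd_simp.
Qed.

(** The interior density is constant, so monotonicity of the cdf alone makes the virtual value
    nondecreasing; the seller's virtual cost is treated in the same way. *)
Lemma two_point_buyer_regular h : 0 <= lo -> hi <= h ->
  regular_marginal h buyer_virtual_value mu.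
Proof.
move=> lo0 hih; exists lo, hi, (fun=> e / (hi - lo)); split => //.
  exact: two_point_density.
have [a0 c0 e0 ace _] := law.
move=> x y lox xy yhi; rewrite /buyer_virtual_value lerB//.
have := cdf_of_nondecreasing xy => cdfxy.
by rewrite ler_pM2r ?invr_gt0 ?divr_gt0 ?subr_gt0// lerB.
Qed.

Lemma two_point_seller_regular h : 0 <= lo -> hi <= h ->
  regular_marginal h seller_virtual_cost mu.
Proof.
move=> lo0 hih; exists lo, hi, (fun=> e / (hi - lo)); split => //.
  exact: two_point_density.
have [a0 c0 e0 ace _] := law.
move=> x y lox xy yhi; rewrite /seller_virtual_cost lerD//.
have := cdf_of_nondecreasing xy => cdfxy.
by rewrite ler_pM2r ?invr_gt0 ?divr_gt0 ?subr_gt0.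
Qed.

Lemma two_point_supp : mu (~` `[lo, hi]%classic) = 0%E.
Proof.
have [+ _ _ _] := two_point_density.
by rewrite probability_setC// => ->; rewrite subee.
Qed.

Lemma two_point_integrable (f : R -> R) :
  mu.-integrable setT (EFin \o f) -> U.-integrable setT (EFin \o f).
Proof.
have [a0 c0 e0 ace lawE] := law.
move=> /integrableP[mf]; rewrite lawE//=; last first.
  by apply/measurable_EFinP/measurableT_comp => //; exact/measurable_EFinP.
move=> fy; apply/integrableP; split => //.
rewrite ltey; apply: contraTN fy => /eqP /= ->.
by rewrite gt0_muley ?lte_fin// -!EFinM addey// addey.
Qed.

(** The law speaks of nonnegative functions, so [f] is split into its positive and negative parts.
    The uniform term is restricted to the open interval, which has full mass, so that later bounds
    on [f] are required only strictly between the atoms. *)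
Lemma two_point_Rintegral (f : R -> R) : mu.-integrable setT (EFin \o f) ->
  \int[mu]_x f x = a * f lo + (c * f hi + e * \int[U]_(x in `]lo, hi[) f x).
Proof.
move=> intf; have [a0 c0 e0 ace lawE] := law.
have Uintf := two_point_integrable intf.
have mf : measurable_fun setT (EFin \o f) := measurable_int _ intf.
have mD : measurable (~` `]lo, hi[%classic : set R) by exact: measurableC.
rewrite /Rintegral -(setCK `]lo, hi[%classic) -setTD.
rewrite -(negligible_integral mD measurableT Uintf uniform_law_oo0).
rewrite integralE [in RHS]integralE.
have pfin := integrable_pos_fin_num measurableT Uintf.
have nfin := integrable_neg_fin_num measurableT Uintf.
rewrite !lawE//; last 2 first.
- exact: measurable_funeneg.
- exact: measurable_funepos.
rewrite -(fineK pfin) -(fineK nfin) -EFinB !funeposE !funenegE /=.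
have maxE (x : R) : maxe x%:E 0%E = (Num.max x 0)%:E by rewrite EFin_max.
rewrite !maxE -!EFinM -!EFinD. rewrite /=.
have mx (x : R) : Num.max x 0 - Num.max (- x) 0 = x.
  by rewrite /Num.max; case: ltP => ?; case: ltP => ?; lra.
by rewrite -[X in _ = a * X + _]mx -[X in _ = _ + (c * X + _)]mx; ring.
Qed.

(** The interior carries mass [e] only, so a crude bound [B] there costs little. This and the
    reverse bound reduce expectations on the hard instances to their atoms. *)
Lemma two_point_Rintegral_le (f : R -> R) (B : R) :
  mu.-integrable setT (EFin \o f) -> (forall x, lo < x < hi -> f x <= B) ->
  \int[mu]_x f x <= a * f lo + c * f hi + e * B.
Proof.
move=> intf fB; have [a0 c0 e0 ace lawE] := law.
rewrite two_point_Rintegral// -addrA !lerD2l ler_pM2l//.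
have -> : B = \int[U]_(x in `]lo, hi[) B.
  by rewrite Rintegral_cst// [X in fine X]uniform_law_oo mulr1.
apply: le_Rintegral => //.
- by apply: integrableS (two_point_integrable intf).
- exact: finite_measure_integrable_cst.
Qed.

Lemma two_point_Rintegral_ge (f : R -> R) (B : R) :
  mu.-integrable setT (EFin \o f) -> (forall x, lo < x < hi -> B <= f x) ->
  a * f lo + c * f hi + e * B <= \int[mu]_x f x.
Proof.
move=> intf fB; have [a0 c0 e0 ace lawE] := law.
rewrite two_point_Rintegral// -addrA !lerD2l ler_pM2l//.
have -> : B = \int[U]_(x in `]lo, hi[) B.
  by rewrite Rintegral_cst// [X in fine X]uniform_law_oo mulr1.
apply: le_Rintegral => //.
- exact: finite_measure_integrable_cst.
- by apply: integrableS (two_point_integrable intf).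
Qed.

End two_point_laws.

Lemma two_point_dominates2 (R : realType) (lo hi : R) (lohi : lo < hi)
    (a c a' c' e : R) (mu nu : probability R R) :
  two_point_law lohi a c e mu -> two_point_law lohi a' c' e nu ->
  dominates2 (a ^+ 2 / a' + c ^+ 2 / c' + e) mu nu.
Proof.
(* Cauchy-Schwarz in each coordinate and for the three weights *)
move=> [a0 c0 e0 ace muE] [a'0 c'0 _ ace' nuE] F mF F0.
have mFF : measurable_fun setT (fun x => F x * F x)%E by exact: emeasurable_funM.
have FF0 x : (0 <= F x * F x)%E by rewrite mule_ge0.
rewrite muE// nuE//.
have := @dominates2_refl _ _ _ (uniform_law lohi) _ mF F0; rewrite mul1e.
move: (F lo) (F0 lo) (F hi) (F0 hi) => x x0 y y0.
have : (0 <= \int[uniform_law lohi]_x F x)%E by exact: integral_ge0.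
have : (0 <= \int[uniform_law lohi]_x (F x * F x))%E by exact: integral_ge0.
move: (\int[uniform_law lohi]_x F x)%E => z.
move: (\int[uniform_law lohi]_x (F x * F x))%E => w w0 z0 zw.
have C0 : 0 < a ^+ 2 / a' + c ^+ 2 / c' + e.
  by rewrite !addr_gt0// divr_gt0// exprn_gt0.
have ge0Ny (u : \bar R) : (0 <= u)%E -> u != -oo%E by case: u.
(* If [F lo], [F hi] or the uniform second moment is infinite, so is the right-hand side; once [w]
   is finite, [zw] makes [z] finite too. *)
case: w w0 zw => [w| |] // w0 zw; last first.
  rewrite [X in (_ <= X)%E](_ : _ = +oo%E) ?leey//.
  rewrite (@gt0_muley _ e%:E) ?lte_fin// [X in (_ + X)%E]addey.
    rewrite addey ?gt0_muley ?lte_fin//.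
    by rewrite ge0Ny// ?mule_ge0 ?mule_ge0 ?lee_fin// ltW.
  by rewrite ge0Ny// ?mule_ge0 ?mule_ge0 ?lee_fin// ltW.
case: z z0 zw => [z| |] // z0 zw.
case: x x0 => [x| |] // x0; last first.
  rewrite [X in (_ <= X)%E](_ : _ = +oo%E) ?leey//.
  rewrite mulyy (@gt0_muley _ a'%:E) ?lte_fin//.
  rewrite addye ?gt0_muley ?lte_fin//.
  by rewrite ge0Ny// adde_ge0 ?mule_ge0 ?mule_ge0 ?lee_fin// ltW.
case: y y0 => [y| |] // y0; last first.
  rewrite [X in (_ <= X)%E](_ : _ = +oo%E) ?leey//.
  rewrite mulyy (@gt0_muley _ c'%:E) ?lte_fin//.
  by rewrite addye// addey ?gt0_muley ?lte_fin.
move: x0 y0 z0 w0 zw.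
rewrite -!EFinM -?EFinD -?EFinM !lee_fin => x0 y0 z0 w0 zw.
apply: (@le_trans _ _ ((a ^+ 2 / a' + c ^+ 2 / c' + e) *
    (a' * (x * x) + (c' * (y * y) + e * (z * z))))); last first.
  by rewrite ler_pM2l// !lerD2l ler_pM2l.
rewrite -subr_ge0.
(* Lagrange's identity: the defect in Cauchy-Schwarz is a sum of squares over the three pairs of
   coordinates. *)
have -> : (a ^+ 2 / a' + c ^+ 2 / c' + e) *
    (a' * (x * x) + (c' * (y * y) + e * (z * z))) -
    (a * x + (c * y + e * z)) * (a * x + (c * y + e * z)) =
    (a * c' * y - c * a' * x) ^+ 2 / (a' * c') +
    e * (a * z - a' * x) ^+ 2 / a' + e * (c * z - c' * y) ^+ 2 / c'.
  by field; rewrite !gt_eqF.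
have [[a'W c'W] eW] := (ltW a'0, ltW c'0, ltW e0).
apply: addr_ge0; [apply: addr_ge0|]; apply: divr_ge0;
  by do ?[exact: sqr_ge0|apply: mulr_ge0].
Qed.

(** * Real-valued Fubini *)

Lemma measurable_slice1 (R : realType) (f : R * R -> R) (x : R) :
  measurable_fun setT f -> measurable_fun setT (fun y => f (x, y)).
Proof. by move=> mf; exact: (measurableT_comp mf (pair1_measurable x)). Qed.

Lemma measurable_slice2 (R : realType) (f : R * R -> R) (y : R) :
  measurable_fun setT f -> measurable_fun setT (fun x => f (x, y)).
Proof. by move=> mf; exact: (measurableT_comp mf (pair2_measurable y)). Qed.

Section real_fubini.
Context d1 d2 (T1 : measurableType d1) (T2 : measurableType d2) (R : realType).
Context (m1 : probability T1 R) (m2 : probability T2 R) (f : T1 * T2 -> R).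
Context (intf : (m1 \x m2)%E.-integrable setT (EFin \o f)).

Lemma integrable_Rintegral1 :
  m1.-integrable setT (fun x => (\int[m2]_y f (x, y))%:E).
Proof.
have intF := integrable_fubini_F intf.
apply: le_integrable intF => //.
  apply/measurable_EFinP/measurableT_comp; first exact: fine_measurable.
  exact: (measurable_fubini_F intf).
move=> x _; rewrite /Rintegral /fubini_F.
by case: integral => [r| |] //=; rewrite normr0 leey.
Qed.

(** The inner integral is finite almost everywhere. Where it is infinite, [fine] replaces it by 0,
    and a change on a null set leaves the outer integral the same. *)
Lemma Rintegral_fubini1 :
  \int[(m1 \x m2)%E]_z f z = \int[m1]_x \int[m2]_y f (x, y).
Proof.
have intF := integrable_fubini_F intf.
rewrite /Rintegral -(integral12_prod_meas1 intf); congr fine.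
apply: ae_eq_integral => //.
- exact: measurable_int intF.
- exact: measurable_int integrable_Rintegral1.
- have := integrable_ae measurableT intF; apply: filterS => x /(_ I) Fx _.
  by rewrite fineK.
Qed.

Lemma integrable_fubini_G : m2.-integrable setT (fubini_G m1 (EFin \o f)).
Proof.
have mf : measurable_fun setT (EFin \o f) := measurable_int _ intf.
have mabs : measurable_fun setT (abse \o (EFin \o f)) by exact: measurableT_comp.
apply/integrableP; split; first exact: (measurable_fubini_G intf).
have [+ _] := integrable21ltyP m1 m2 mf.
move=> /(_ intf); apply: le_lt_trans.
apply: ge0_le_integral => //.
- by apply: measurableT_comp => //; exact: (measurable_fubini_G intf).
- by apply: (measurable_fun_fubini_tonelli_G (abse \o (EFin \o f))) => /= *.
- move=> y _; apply: le_abse_integral => //.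
  exact: (measurableT_comp mf (pair2_measurable y)).
Qed.

Lemma integrable_Rintegral2 :
  m2.-integrable setT (fun y => (\int[m1]_x f (x, y))%:E).
Proof.
have intF := integrable_fubini_G.
apply: le_integrable intF => //.
  apply/measurable_EFinP/measurableT_comp; first exact: fine_measurable.
  exact: (measurable_fubini_G intf).
move=> x _; rewrite /Rintegral /fubini_G.
by case: integral => [r| |] //=; rewrite normr0 leey.
Qed.

Lemma Rintegral_fubini2 :
  \int[(m1 \x m2)%E]_z f z = \int[m2]_y \int[m1]_x f (x, y).
Proof.
have intF := integrable_fubini_G.
rewrite /Rintegral -(integral21_prod_meas1 intf); congr fine.
apply: ae_eq_integral => //.
- exact: measurable_int intF.
- exact: measurable_int integrable_Rintegral2.
- have := integrable_ae measurableT intF; apply: filterS => x /(_ I) Fx _.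
  by rewrite fineK.
Qed.

End real_fubini.

Lemma integrable_bounded_on d (T : measurableType d) (R : realType)
    (mu : probability T R) (A : set T) (B : R) (f : T -> R) :
  measurable A -> mu (~` A) = 0%E -> measurable_fun setT f ->
  (forall x, A x -> `|f x| <= B) -> mu.-integrable setT (EFin \o f).
Proof.
move=> mA muA mf fB; apply/(negligible_integrable (measurableC mA)) => //.
  exact/measurable_EFinP.
rewrite setTD setCK; apply: measurable_bounded_integrable => //.
- by rewrite (le_lt_trans (probability_le1 _ _))// ltry.
- exact: measurable_funS mf.
- exists B; split; first exact: num_real.
  by move=> y By x Ax /=; rewrite (le_trans (fB _ Ax))// ltW.
Qed.

Lemma integrable_bounded d (T : measurableType d) (R : realType)
    (mu : probability T R) (B : R) (f : T -> R) : measurable_fun setT f ->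
  (forall x, `|f x| <= B) -> mu.-integrable setT (EFin \o f).
Proof.
move=> mf fB; apply: (@integrable_bounded_on _ _ _ _ setT B) => //.
by rewrite setCT measure0.
Qed.

Lemma product_supp d1 d2 (T1 : measurableType d1) (T2 : measurableType d2)
    (R : realType) (m1 : probability T1 R) (m2 : probability T2 R)
    (A1 : set T1) (A2 : set T2) : measurable A1 -> measurable A2 ->
  m1 (~` A1) = 0%E -> m2 (~` A2) = 0%E -> (m1 \x m2)%E (~` (A1 `*` A2)) = 0%E.
Proof.
move=> mA1 mA2 m1A m2A.
have full d (T : measurableType d) (m : probability T R) A :
    measurable A -> m (~` A) = 0%E -> m A = 1%E.
  by move=> mA mA0; rewrite -[A]setCK probability_setC ?mA0 ?sube0//; exact: measurableC.
have m12 : (m1 A1 * m2 A2 = 1)%E by rewrite (full _ _ m1)// (full _ _ m2)// mule1.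
rewrite probability_setC; last exact: measurableX.
by rewrite [X in (_ - X)%E](etrans (product_measure1E m1 m2 mA1 mA2) m12) subee.
Qed.

(** * Threshold mechanisms *)

Section threshold_mechanism.
Context {R : realType}.
Context (h b c : R) (hi : bool).

(** Each agent faces a posted price set by the other's report. The buyer's price is [b] against a
    cost at most 0 and, with [hi], [h] against a positive cost up to [c]; the seller is offered [c]
    if [hi] holds and the value is at least [h], and 0 against other values from [b] on. *)
Let low (r : R * R) : bool := (b <= r.1) && (r.2 <= 0).
Let high (r : R * R) : bool := [&& hi, h <= r.1 & r.2 <= c].

Definition threshold_trade (r : R * R) : R := if low r || high r then 1 else 0.
Definition threshold_buyer_pays (r : R * R) : R :=
  if low r then b else if high r then h else 0.
Definition threshold_seller_gets (r : R * R) : R := if high r then c else 0.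

Let measurable_low : measurable_fun setT low.
Proof. by apply: measurable_and; exact: measurable_fun_ler. Qed.

Let measurable_high : measurable_fun setT high.
Proof.
apply: measurable_and => //.
by apply: measurable_and; exact: measurable_fun_ler.
Qed.

Lemma threshold_trade_measurable : measurable_fun setT threshold_trade.
Proof. by apply: measurable_fun_ifT => //; exact: measurable_or. Qed.

Lemma threshold_buyer_pays_measurable : measurable_fun setT threshold_buyer_pays.
Proof. by apply: measurable_fun_ifT => //; exact: measurable_fun_ifT. Qed.

Lemma threshold_seller_gets_measurable :
  measurable_fun setT threshold_seller_gets.
Proof. exact: measurable_fun_ifT. Qed.

Lemma threshold_trade_prob r : 0 <= threshold_trade r <= 1.
Proof. by rewrite /threshold_trade; case: ifP; rewrite ?lexx ler01. Qed.

Definition threshold_mechanism : mechanism R :=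
  Mechanism threshold_trade_measurable threshold_buyer_pays_measurable
    threshold_seller_gets_measurable threshold_trade_prob.

Context (b0 : 0 <= b) (bh : b <= h) (c0 : 0 <= c) (DB DS : probability R R).

Lemma threshold_trade_bounded r : `|threshold_trade r| <= 1.
Proof.
by have /andP[? ?] := threshold_trade_prob r; rewrite ger0_norm.
Qed.

Lemma threshold_buyer_pays_bounded r : `|threshold_buyer_pays r| <= h.
Proof.
have h0 : 0 <= h by exact: le_trans bh.
by rewrite /threshold_buyer_pays; do ?case: ifP => _; rewrite ?normr0// ger0_norm.
Qed.

Lemma threshold_seller_gets_bounded r : `|threshold_seller_gets r| <= c.
Proof.
by rewrite /threshold_seller_gets; case: ifP => _; rewrite ?normr0// ger0_norm.
Qed.

Lemma threshold_payments_integrable :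
  payments_integrable h DB DS threshold_mechanism.
Proof.
split=> [x _|y _||].
- apply: integrable_bounded (measurable_slice1 x threshold_buyer_pays_measurable) _ => y.
  exact: threshold_buyer_pays_bounded.
- apply: integrable_bounded (measurable_slice2 y threshold_seller_gets_measurable) _ => x.
  exact: threshold_seller_gets_bounded.
- exact: integrable_bounded threshold_buyer_pays_measurable
    threshold_buyer_pays_bounded.
- exact: integrable_bounded threshold_seller_gets_measurable
    threshold_seller_gets_bounded.
Qed.

Let integrable_buyer v x :
  DS.-integrable setT (EFin \o (fun s =>
    v * threshold_trade (x, s) - threshold_buyer_pays (x, s))).
Proof.
apply: (@integrable_bounded _ _ _ _ (`|v| + h)).
  apply: measurable_funB; last exact: measurable_slice1 threshold_buyer_pays_measurable.
  by apply: measurable_funM => //; exact: measurable_slice1 threshold_trade_measurable.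
move=> s; rewrite (le_trans (ler_normB _ _))// lerD//.
  by rewrite normrM ler_piMr// threshold_trade_bounded.
exact: threshold_buyer_pays_bounded.
Qed.

Let integrable_seller v y :
  DB.-integrable setT (EFin \o (fun x =>
    threshold_seller_gets (x, y) - v * threshold_trade (x, y))).
Proof.
apply: (@integrable_bounded _ _ _ _ (c + `|v|)).
  apply: measurable_funB; first exact: measurable_slice2 threshold_seller_gets_measurable.
  by apply: measurable_funM => //; exact: measurable_slice2 threshold_trade_measurable.
move=> s; rewrite (le_trans (ler_normB _ _))// lerD//.
  exact: threshold_seller_gets_bounded.
by rewrite normrM ler_piMr// threshold_trade_bounded.
Qed.

(** Truth-telling is optimal against every single report of the other side, so [BIC] follows by
    integration under any pair of priors. *)
Lemma threshold_buyer_IC v v' s : v <= h ->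
  v * threshold_trade (v', s) - threshold_buyer_pays (v', s) <=
  v * threshold_trade (v, s) - threshold_buyer_pays (v, s).
Proof.
move=> vh; rewrite /threshold_trade /threshold_buyer_pays /low /high /=.
case: (leP s 0) => s0; case: (leP b v) => bv; case: (leP b v') => bv';
  rewrite /= ?andbF /=; do ?case: ifP => [/and3P[? ? ?]|_]; lra.
Qed.

Lemma threshold_seller_IC x v v' : 0 <= v ->
  threshold_seller_gets (x, v') - v * threshold_trade (x, v') <=
  threshold_seller_gets (x, v) - v * threshold_trade (x, v).
Proof.
move=> v0; rewrite /threshold_trade /threshold_seller_gets /low /high /=.
case: (boolP (hi && (h <= x))) => [/andP[-> hx]|hhx].
  have bx := le_trans bh hx; rewrite hx bx /=.
  case: (leP v c) => vc; case: (leP v' c) => v'c; case: (leP v 0) => v00;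
    case: (leP v' 0) => v'0 /=; lra.
have E y : [&& hi, h <= x & y <= c] = false.
  by rewrite andbA (negbTE hhx).
rewrite !E !orbF; case: (leP b x) => bx /=; last by lra.
case: (leP v 0) => v00; case: (leP v' 0) => v'0; lra.
Qed.

Lemma threshold_BIC : BIC h DB DS threshold_mechanism.
Proof.
split=> v v' /andP[v0 vh] /andP[v'0 v'h].
- apply: le_Rintegral; [by []|exact: integrable_buyer|exact: integrable_buyer|].
  by move=> s _; exact: threshold_buyer_IC.
- apply: le_Rintegral; [by []|exact: integrable_seller|exact: integrable_seller|].
  by move=> x _; exact: threshold_seller_IC.
Qed.

Lemma threshold_IIR : IIR h DB DS threshold_mechanism.
Proof.
split=> v /andP[v0 vh]; apply: Rintegral_ge0 => x _.
- rewrite /= /threshold_trade /threshold_buyer_pays /low /high /=.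
  case: (leP b v) => bv; case: (leP x 0) => x0;
    rewrite /= ?andbF /=; do ?case: ifP => [/and3P[? ? ?]|_]; lra.
- rewrite /= /threshold_trade /threshold_seller_gets /low /high /=.
  case: (leP v 0) => v00; case: (leP b x) => bx;
    rewrite /= ?andbF /=; do ?case: ifP => [/and3P[? ? ?]|_]; lra.
Qed.

End threshold_mechanism.

(** * The hard instances *)

Section hard_instance.
Context {R : realType} (h b e p : R).
Context (b0 : 0 < b) (b16 : 16 * b <= h) (bh : b < h) (sh0 : 0 < 3 / 4 * h).
Context (DB DS : probability R R).
Context (lawB : two_point_law bh (1 - p - e) p e DB).
Context (lawS : two_point_law sh0 (1 / 2) (1 / 2 - e) e DS).
Implicit Type M : mechanism R.

Lemma hard_instance_weights : [/\ 0 < p, 0 < e, p + e < 1, e < 1 / 2 &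
  [/\ 0 < b, 16 * b <= h & 0 < h]].
Proof.
move: b0 b16 => b0' b16'.
by case: lawB => ? ? ? _ _; case: lawS => ? ? ? _ _; split; [..|split]; lra.
Qed.

Let suppB := two_point_supp lawB.
Let suppS := two_point_supp lawS.

Lemma GFT_measurable M :
  measurable_fun setT (fun r : R * R => trade M r * (r.1 - r.2)).
Proof.
apply: measurable_funM; first exact: trade_measurable.
by apply: measurable_funB.
Qed.

Lemma GFT_integrable M :
  (DB \x DS)%E.-integrable setT
    (EFin \o (fun r : R * R => trade M r * (r.1 - r.2))).
Proof.
have [p0 e0 pe e2 [b0' b16' h0]] := hard_instance_weights.
apply: (@integrable_bounded_on _ _ _ _ (`[b, h]%classic `*` `[0, 3 / 4 * h]%classic) h).
- exact: measurableX.
- exact: product_supp.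
- exact: GFT_measurable.
- move=> [x y] [] /=; rewrite !in_itv/= => /andP[bx xh] /andP[y0 yh].
  have /andP[t0 t1] := trade_prob M (x, y).
  rewrite normrM (ger0_norm t0).
  have : `|x - y| <= h by rewrite ler_norml; apply/andP; split; lra.
  by move: (normr_ge0 (x - y)) => ? ?; nra.
Qed.

Let gains M x := \int[DS]_s (trade M (x, s) * (x - s)).

Let gains_integrable M x : b <= x <= h ->
  DS.-integrable setT (EFin \o (fun s => trade M (x, s) * (x - s))).
Proof.
have [p0 e0 pe e2 [b0' b16' h0]] := hard_instance_weights.
move=> /andP[bx xh].
apply: (@integrable_bounded_on _ _ _ _ `[0, 3 / 4 * h]%classic h) => //.
  exact: (measurable_slice1 x (GFT_measurable M)).
move=> y /=; rewrite in_itv/= => /andP[y0 yh].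
have /andP[t0 t1] := trade_prob M (x, y).
rewrite normrM (ger0_norm t0).
have : `|x - y| <= h by rewrite ler_norml; apply/andP; split; lra.
by move: (normr_ge0 (x - y)) => ? ?; nra.
Qed.

Let gains_le M x : b <= x <= h ->
  gains M x <= 1 / 2 * (trade M (x, 0) * (x - 0)) +
    (1 / 2 - e) * (trade M (x, 3 / 4 * h) * (x - 3 / 4 * h)) + e * h.
Proof.
have [p0 e0 pe e2 [b0' b16' h0]] := hard_instance_weights.
move=> xh; apply: (two_point_Rintegral_le lawS (gains_integrable M xh)).
move=> s /andP[s0 sh]; have /andP[t0 t1] := trade_prob M (x, s).
by move/andP: xh => [? ?]; nra.
Qed.

Let gains_ge M x : b <= x <= h ->
  (forall s, 0 <= s <= 3 / 4 * h -> 0 <= trade M (x, s) * (x - s)) ->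
  1 / 2 * (trade M (x, 0) * (x - 0)) +
    (1 / 2 - e) * (trade M (x, 3 / 4 * h) * (x - 3 / 4 * h)) <= gains M x.
Proof.
have [p0 e0 pe e2 [b0' b16' h0]] := hard_instance_weights.
move=> xh pos; rewrite -[X in X <= _]addr0 -[X in _ + X <= _](mulr0 e).
apply: (two_point_Rintegral_ge lawS (gains_integrable M xh)).
by move=> s /andP[s0 sh]; apply: pos; rewrite !ltW.
Qed.

(** The pair of atoms [b] and [3 / 4 * h] can only trade at a loss and is dropped; the uniform parts
    of the two marginals add at most [e * h] each. *)
Lemma GFT_le M :
  GFT DB DS M <= p * (1 / 2 * (trade M (h, 0) * h) +
                      (1 / 2 - e) * (trade M (h, 3 / 4 * h) * (h / 4))) +
                 (1 - p - e) * (1 / 2 * (trade M (b, 0) * b)) + 2 * e * h.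
Proof.
have [p0 e0 pe e2 [b0' b16' h0]] := hard_instance_weights.
rewrite /GFT Rintegral_fubini1; last exact: GFT_integrable.
apply: (le_trans (two_point_Rintegral_le (B := h) lawB
  (integrable_Rintegral1 (GFT_integrable M)) _)).
  move=> x /andP[bx xh].
  have xbh : b <= x <= h by rewrite !ltW.
  apply: (le_trans (gains_le M xbh)).
  have /andP[t0 t1] := trade_prob M (x, 0).
  have /andP[u0 u1] := trade_prob M (x, 3 / 4 * h).
  have t2 : trade M (x, 0) * (x - 0) <= h by nra.
  have u2 : trade M (x, 3 / 4 * h) * (x - 3 / 4 * h) <= h by nra.
  nra.
have bb : b <= b <= h by rewrite lexx ltW.
have hh : b <= h <= h by rewrite lexx ltW.
have := gains_le M bb; have := gains_le M hh; rewrite /gains /= !subr0.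
have /andP[d0 d1] := trade_prob M (b, 3 / 4 * h).
move: (Rintegral _ _ _) (Rintegral _ _ _) => Gb Gh GhE GbE.
have d2 : (1 / 2 - e) * (trade M (b, 3 / 4 * h) * (b - 3 / 4 * h)) <= 0.
  apply: mulr_ge0_le0; first by lra.
  by apply: mulr_ge0_le0 => //; lra.
have GbE' : Gb <= 1 / 2 * (trade M (b, 0) * b) + e * h by lra.
have GhE' : Gh <= 1 / 2 * (trade M (h, 0) * h) +
  (1 / 2 - e) * (trade M (h, 3 / 4 * h) * (h / 4)) + e * h.
  by move: GhE; rewrite (_ : h - 3 / 4 * h = h / 4)//; lra.
have eh : 0 < e * h by exact: mulr_gt0.
have H1 := ler_wpM2l (ltW p0) GhE'.
have pe0 : 0 <= 1 - p - e by lra.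
have H2 := ler_wpM2l pe0 GbE'.
have H3 : (1 - e) * (e * h) <= e * h by nra.
lra.
Qed.

(** When no trade on the support rectangle is made at a loss, the uniform parts contribute
    nonnegative gains and can be discarded. *)
Lemma GFT_ge M :
  (forall x s, b <= x <= h -> 0 <= s <= 3 / 4 * h ->
     0 <= trade M (x, s) * (x - s)) ->
  p * (1 / 2 * (trade M (h, 0) * h) +
       (1 / 2 - e) * (trade M (h, 3 / 4 * h) * (h / 4))) +
  (1 - p - e) * (1 / 2 * (trade M (b, 0) * b) +
       (1 / 2 - e) * (trade M (b, 3 / 4 * h) * (b - 3 / 4 * h)))
  <= GFT DB DS M.
Proof.
move=> pos; have [p0 e0 pe e2 [b0' b16' h0]] := hard_instance_weights.
rewrite /GFT Rintegral_fubini1; last exact: GFT_integrable.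
apply: le_trans (two_point_Rintegral_ge (B := 0) lawB
  (integrable_Rintegral1 (GFT_integrable M)) _); last first.
  move=> x /andP[bx xh].
  have xbh : b <= x <= h by rewrite !ltW.
  have := gains_ge xbh (fun s => pos x s xbh); apply: le_trans.
  apply: addr_ge0; apply: mulr_ge0; try lra;
    by apply: pos => //; apply/andP; split; lra.
have bb : b <= b <= h by rewrite lexx ltW.
have hh : b <= h <= h by rewrite lexx ltW.
have := gains_ge bb (fun s => pos b s bb).
have := gains_ge hh (fun s => pos h s hh); rewrite /gains /= !subr0.
move: (Rintegral _ _ _) (Rintegral _ _ _) => Gb Gh.
rewrite (_ : h - 3 / 4 * h = h / 4); last lra.
move=> /(ler_wpM2l (ltW p0)) H1.
have pe0 : 0 <= 1 - p - e by lra.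
by move=> /(ler_wpM2l pe0) H2; lra.
Qed.

(** Reduced form: the interim utilities depend on [M] only through the trade probability and payment
    expected by the buyer ([Q], [X]) and by the seller ([P], [Y]). *)
Let Q M x := \int[DS]_s trade M (x, s).
Let X M x := \int[DS]_s buyer_pays M (x, s).
Let P M s := \int[DB]_x trade M (x, s).
Let Y M s := \int[DB]_x seller_gets M (x, s).

Let trade_bound M r : `|trade M r| <= 1.
Proof. by have /andP[? ?] := trade_prob M r; rewrite ger0_norm. Qed.

Let trade_integrable1 M x : DS.-integrable setT (EFin \o (fun s => trade M (x, s))).
Proof.
apply: (@integrable_bounded _ _ _ _ 1); last by move=> s; exact: trade_bound.
exact: (measurable_slice1 x (trade_measurable M)).
Qed.

Let trade_integrable2 M s : DB.-integrable setT (EFin \o (fun x => trade M (x, s))).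
Proof.
apply: (@integrable_bounded _ _ _ _ 1); last by move=> x; exact: trade_bound.
exact: (measurable_slice2 s (trade_measurable M)).
Qed.

Let buyer_utilityE M v x : payments_integrable h DB DS M -> 0 <= x <= h ->
  buyer_utility DS M v x = v * Q M x - X M x.
Proof.
move=> [intX _ _ _] xh; rewrite /buyer_utility RintegralB//.
- by rewrite RintegralZl//; exact: trade_integrable1.
- exact: (integrableZl _ v (trade_integrable1 M x)).
- exact: intX.
Qed.

Let seller_utilityE M v s : payments_integrable h DB DS M -> 0 <= s <= h ->
  seller_utility DB M v s = Y M s - v * P M s.
Proof.
move=> [_ intY _ _] sh; rewrite /seller_utility RintegralB//.
- by rewrite RintegralZl//; exact: trade_integrable2.
- exact: intY.
- exact: (integrableZl _ v (trade_integrable2 M s)).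
Qed.

(* Only two incentive constraints matter: value [h] must not envy [b] and cost
   [0] must not envy [3 / 4 * h]. *)
Lemma feasible_revenue M : b <= p * h -> feasible h DB DS M ->
  0 <= p * h * (1 / 2 * trade M (h, 0) + 1 / 2 * trade M (h, 3 / 4 * h) + e) -
       (p * h - b) * (1 / 2 * trade M (b, 0)) + e * h -
       (1 - e) * (3 / 4 * h * (p * trade M (h, 3 / 4 * h))).
Proof.
move=> bph [pay [ICB ICS] [IRB IRS]].
have [p0 e0 pe e2 [b0' b16' h0]] := hard_instance_weights.
have [_ _ intX intY] := pay.
rewrite /WBB /Rev RintegralB// (Rintegral_fubini1 intX) (Rintegral_fubini2 intY).
have inB x : b <= x <= h -> 0 <= x <= h.
  by move=> /andP[? ?]; apply/andP; split; lra.
have inS s : 0 <= s <= 3 / 4 * h -> 0 <= s <= h.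
  by move=> /andP[? ?]; apply/andP; split; lra.
have Q01 x : 0 <= Q M x <= 1.
  apply/andP; split.
    by apply: Rintegral_ge0 => s _; have /andP[] := trade_prob M (x, s).
  rewrite -[X in _ <= X](_ : \int[DS]_s 1 = 1); last first.
    by rewrite Rintegral_cst// [X in fine X]probability_setT mulr1.
  apply: le_Rintegral => //.
    exact: finite_measure_integrable_cst.
  by move=> s _; have /andP[] := trade_prob M (x, s).
have P0 s : 0 <= P M s.
  by apply: Rintegral_ge0 => x _; have /andP[] := trade_prob M (x, s).
have IRx x : 0 <= x <= h -> X M x <= x * Q M x.
  by move=> xh; have := IRB _ xh; rewrite buyer_utilityE//; lra.
have IRs s : 0 <= s <= h -> s * P M s <= Y M s.
  by move=> sh; have := IRS _ sh; rewrite seller_utilityE//; lra.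
have bb : 0 <= b <= h by apply/andP; split; lra.
have hh : 0 <= h <= h by rewrite lexx ltW.
have zz : (0 : R) <= 0 <= h by rewrite lexx ltW.
have ss : 0 <= 3 / 4 * h <= h by apply/andP; split; lra.
have IChb : h * Q M b - X M b <= h * Q M h - X M h.
  by have := ICB _ _ hh bb; rewrite !buyer_utilityE.
have IC0s : Y M (3 / 4 * h) <= Y M 0.
  by have := ICS _ _ zz ss; rewrite !seller_utilityE// !mul0r !subr0.
(* Off the atoms individual rationality suffices: a buyer pays at most [h] and a seller receives at
   least 0. *)
have revX : \int[DB]_x X M x <= (1 - p - e) * X M b + p * X M h + e * h.
  apply: (two_point_Rintegral_le lawB (integrable_Rintegral1 intX)).
  move=> x /andP[bx xh]; have xh' : 0 <= x <= h by apply/andP; split; lra.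
  have := IRx _ xh'; have /andP[q0 q1] := Q01 x; move: xh' => /andP[? ?].
  by rewrite -/(X M x); nra.
have revY : 1 / 2 * Y M 0 + (1 / 2 - e) * Y M (3 / 4 * h) + e * 0 <=
    \int[DS]_s Y M s.
  apply: (two_point_Rintegral_ge lawS (integrable_Rintegral2 intY)).
  move=> s /andP[s0 sh]; have sh' : 0 <= s <= h by apply/andP; split; lra.
  by have := IRs _ sh'; apply: le_trans; rewrite mulr_ge0// ltW.
have Qh : Q M h <= 1 / 2 * trade M (h, 0) +
    (1 / 2 - e) * trade M (h, 3 / 4 * h) + e * 1.
  apply: (two_point_Rintegral_le lawS (trade_integrable1 M h)) => s _.
  by have /andP[] := trade_prob M (h, s).
have Qb : 1 / 2 * trade M (b, 0) + (1 / 2 - e) * trade M (b, 3 / 4 * h) + e * 0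
    <= Q M b.
  apply: (two_point_Rintegral_ge lawS (trade_integrable1 M b)) => s _.
  by have /andP[] := trade_prob M (b, s).
have Ps : (1 - p - e) * trade M (b, 3 / 4 * h) + p * trade M (h, 3 / 4 * h) +
    e * 0 <= P M (3 / 4 * h).
  apply: (two_point_Rintegral_ge lawB (trade_integrable2 M (3 / 4 * h))) => x _.
  by have /andP[] := trade_prob M (x, 3 / 4 * h).
move=> rev; apply: (le_trans rev).
have -> : (\int[DB]_x \int[DS]_y buyer_pays M (x, y)) = \int[DB]_x X M x by [].
have -> : (\int[DS]_y \int[DB]_x seller_gets M (x, y)) = \int[DS]_s Y M s by [].
move: revX revY => {rev}.
move: (\int[DB]_x X M x) (\int[DS]_s Y M s) => rX rY revX revY.
have /andP[d0 d1] := trade_prob M (b, 3 / 4 * h).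
have /andP[u0 u1] := trade_prob M (h, 3 / 4 * h).
have /andP[qb0 qb1] := Q01 b.
have irb := IRx _ bb; have irs := IRs _ ss.
move: Qh Qb Ps qb0 irb irs IChb IC0s revX revY d0 u0 {IRx IRs ICB ICS IRB IRS P0 Q01}.
move: (Q M h) (Q M b) (P M (3 / 4 * h)) (X M b) (X M h) (Y M 0) (Y M (3 / 4 * h)).
move: (trade M (b, 0)) (trade M (h, 0)) (trade M (h, 3 / 4 * h))
  (trade M (b, 3 / 4 * h)) => tb th u d qh qb ps xb xh y0 ys.
move=> Qh Qb Ps qb0 irb irs IChb IC0s revX revY d0 u0.
(* Value [h] must keep the rent it would obtain by reporting [b]; the payment at [b] is in turn
   capped by individual rationality. *)
have xbh : p * xh <= p * (h * qh - h * qb + xb) by rewrite ler_pM2l//; lra.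
have xbb : (1 - e) * xb <= (1 - e) * (b * qb) by rewrite ler_pM2l//; lra.
have eqb : 0 <= e * (b * qb) by rewrite !mulr_ge0// ltW.
(* Since [b <= p * h], trading with value [b] loses more in rent to value [h] than it earns, so [qb]
   may be replaced by its lower bound. *)
have cqb : 0 <= (p * h - b) * (qb - 1 / 2 * tb).
  have d2 : 0 <= (1 / 2 - e) * d by rewrite mulr_ge0//; lra.
  by rewrite mulr_ge0//; lra.
have eu : 0 <= e * u by rewrite mulr_ge0// ltW.
have ph0 : 0 <= p * h by rewrite mulr_ge0// ltW.
have cqh : p * h * qh <= p * h * (1 / 2 * th + 1 / 2 * u + e).
  by rewrite ler_wpM2l//; lra.
have cps : p * u <= ps.
  have d2 : 0 <= (1 - p - e) * d by rewrite mulr_ge0//; lra.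
  lra.
(* Cost 0 receives at least what cost [3 / 4 * h] does, so the larger payment is due with
   probability [1 - e]. *)
have cys : (1 - e) * (3 / 4 * h * (p * u)) <= (1 - e) * ys.
  rewrite ler_pM2l; last lra.
  by apply: le_trans irs; rewrite ler_pM2l//; lra.
lra.
Qed.

End hard_instance.

(** * Threshold mechanisms as benchmarks on the hard instance *)

Section threshold_on_hard_instance.
Context {R : realType} (h b e p : R).
Context (b0 : 0 < b) (b16 : 16 * b <= h) (bh : b < h) (sh0 : 0 < 3 / 4 * h).
Context (DB DS : probability R R).
Context (lawB : two_point_law bh (1 - p - e) p e DB).
Context (lawS : two_point_law sh0 (1 / 2) (1 / 2 - e) e DS).

Local Notation M0 := (threshold_mechanism h b (3 / 4 * h) false).
Local Notation M1 := (threshold_mechanism h b (3 / 4 * h) true).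

Lemma threshold_feasible_low : feasible h DB DS M0.
Proof.
split.
- by apply: threshold_payments_integrable; exact: ltW.
- by apply: threshold_BIC; exact: ltW.
- by apply: threshold_IIR; exact: ltW.
- apply: Rintegral_ge0 => r _.
  rewrite /= /threshold_buyer_pays /threshold_seller_gets subr0.
  by case: ifP => _ //; exact: ltW.
Qed.

(** At value [h] the mechanism loses [3 / 4 * h - b] on cost 0 and gains [h / 4] on positive costs;
    at lower values in the support it gains [b] on cost 0. The expected revenue is thus at least
    [b / 2 - p * h / 4], a bound that vanishes at [p * h = 2 * b]. *)
Lemma threshold_feasible_high : p * h <= 2 * b -> feasible h DB DS M1.
Proof.
move=> phb; have [p0 e0 pe e2 [b0' b16' h0]] :=
  hard_instance_weights b0 b16 lawB lawS.
have pay : payments_integrable h DB DS M1.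
  by apply: threshold_payments_integrable; exact: ltW.
split => //.
- by apply: threshold_BIC; exact: ltW.
- by apply: threshold_IIR; exact: ltW.
have [_ _ intX intY] := pay.
pose r x := buyer_pays M1 x - seller_gets M1 x.
have intr : (DB \x DS)%E.-integrable setT (EFin \o r).
  exact: (integrableB measurableT intX intY).
have mr : measurable_fun setT r.
  apply: measurable_funB; [exact: buyer_pays_measurable|
    exact: seller_gets_measurable].
have intr1 x : DS.-integrable setT (EFin \o (fun s => r (x, s))).
  apply: (@integrable_bounded _ _ _ _ (h + 3 / 4 * h)).
    exact: (measurableT_comp mr (pair1_measurable x)).
  move=> s; rewrite (le_trans (ler_normB _ _))// lerD//.
    by apply: threshold_buyer_pays_bounded; exact: ltW.
  by apply: threshold_seller_gets_bounded; exact: ltW.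
have rlow x s : b <= x < h -> 0 <= s -> r (x, s) = if s <= 0 then b else 0.
  move=> /andP[bx xh] s0.
  rewrite /r /= /threshold_buyer_pays /threshold_seller_gets /=.
  by rewrite bx (leNgt h x) xh /= subr0.
have rhigh s : 0 <= s <= 3 / 4 * h ->
    r (h, s) = if s <= 0 then b - 3 / 4 * h else h - 3 / 4 * h.
  move=> /andP[s0 sh].
  rewrite /r /= /threshold_buyer_pays /threshold_seller_gets /=.
  by rewrite (ltW bh) lexx sh /=; case: ifP.
have Ilow x : b <= x < h -> 1 / 2 * b <= \int[DS]_s r (x, s).
  move=> xbh.
  have := two_point_Rintegral_ge (B := 0) lawS (intr1 x).
  rewrite (rlow x 0)// lexx (rlow x (3 / 4 * h) xbh (ltW sh0)) (leNgt _ 0) sh0 /=.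
  rewrite !mulr0 !addr0; apply => s /andP[s0 _].
  by rewrite (rlow x s xbh (ltW s0)); case: ifP => // _; exact: ltW.
have Ihigh : 1 / 2 * b - 1 / 4 * h <= \int[DS]_s r (h, s).
  have := two_point_Rintegral_ge (B := 1 / 4 * h) lawS (intr1 h).
  rewrite (rhigh 0) ?lexx ?(ltW sh0)// (rhigh (3 / 4 * h)) ?lexx ?(ltW sh0)//.
  rewrite (leNgt (3 / 4 * h) 0) sh0 /= => H; apply: le_trans (H _); first by lra.
  move=> s /andP[s0 s1]; rewrite (rhigh s) ?(ltW s0) ?(ltW s1)//.
  by rewrite (leNgt s 0) s0 /=; lra.
rewrite /WBB /Rev -/r (Rintegral_fubini1 intr).
apply: le_trans (two_point_Rintegral_ge (B := 1 / 2 * b) lawB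
  (integrable_Rintegral1 intr) _); last first.
  by move=> x /andP[bx xh]; apply: Ilow; rewrite ltW.
have bbh : b <= b < h by rewrite lexx.
have := ler_wpM2l (ltW p0) Ihigh.
have pe0 : 0 <= 1 - p - e by lra.
have := ler_wpM2l pe0 (Ilow _ bbh).
lra.
Qed.

Lemma threshold_GFT (hi : bool) :
  p * (1 / 2 * h + (if hi then (1 / 2 - e) * (h / 4) else 0)) +
    (1 - p - e) * (1 / 2 * b) <=
  GFT DB DS (threshold_mechanism h b (3 / 4 * h) hi).
Proof.
have [p0 e0 pe e2 [b0' b16' h0]] :=
  hard_instance_weights b0 b16 lawB lawS.
have pos x s : b <= x <= h -> 0 <= s <= 3 / 4 * h ->
    0 <= trade (threshold_mechanism h b (3 / 4 * h) hi) (x, s) * (x - s).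
  move=> /andP[bx xh] /andP[s0 sh]; rewrite /= /threshold_trade bx sh andbT /=.
  by case: (leP s 0) => s00; case: (leP h x) => hx; case: (hi) => /=; lra.
apply: le_trans (GFT_ge b0 b16 lawB lawS pos).
rewrite /= /threshold_trade /= lexx (ltW bh) lexx (leNgt _ 0) sh0 lexx.
rewrite (leNgt h b) bh /= !andbF andbT lexx /=.
by case: (hi) => /=; lra.
Qed.

(** A bound uniform in [M] makes the supremum [SB] meaningful: any feasible mechanism then bounds it
    from below. *)
Lemma GFT_ub (M : mechanism R) : GFT DB DS M <= p * h + b + 2 * e * h.
Proof.
have [p0 e0 pe e2 [b0' b16' h0]] :=
  hard_instance_weights b0 b16 lawB lawS.
apply: (le_trans (GFT_le b0 b16 lawB lawS M)).
have scale (t y : R) : 0 <= y -> 0 <= t <= 1 -> 0 <= t * y <= y.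
  by move=> y0 /andP[t0 t1]; rewrite mulr_ge0//= ler_piMl.
have /andP[x0 x1] := scale _ _ (ltW h0) (trade_prob M (h, 0)).
have /andP[y0 y1] := scale _ _ (ltW b0') (trade_prob M (b, 0)).
have h4 : 0 <= h / 4 by lra.
have /andP[z0 z1] := scale _ _ h4 (trade_prob M (h, 3 / 4 * h)).
rewrite lerD2r; apply: lerD.
  have ez := mulr_ge0 (ltW e0) z0.
  by rewrite ler_pM2l//; lra.
have pe1 : 0 <= 1 - p - e <= 1 by apply/andP; split; lra.
have y2 : 0 <= 1 / 2 * (trade M (b, 0) * b) by lra.
by have /andP[] := scale _ _ y2 pe1; lra.
Qed.

Lemma le_SB (M : mechanism R) : feasible h DB DS M -> GFT DB DS M <= SB h DB DS.
Proof.
move=> fM; apply: ub_le_sup; last by exists M.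
by exists (p * h + b + 2 * e * h) => _ [M' _ <-]; exact: GFT_ub.
Qed.

Lemma SB_ub : SB h DB DS <= p * h + b + 2 * e * h.
Proof.
apply: ge_sup; last by move=> _ [M' _ <-]; exact: GFT_ub.
by exists (GFT DB DS M0); exists M0 => //; exact: threshold_feasible_low.
Qed.

End threshold_on_hard_instance.

(** * Indistinguishability *)

(** A division-free form of [(1 + x)^m <= 1 / (1 - m x)]; the induction rests on
    [(1 - (m + 1) x) (1 + x) <= 1 - m x]. *)
Lemma pow1Dn_le (R : realFieldType) (x : R) (m : nat) :
  0 <= x -> (1 - m%:R * x) * (1 + x) ^+ m <= 1.
Proof.
move=> x0; elim: m => [|m IHm]; first by rewrite mul0r subr0 expr0 mulr1.
apply: le_trans IHm; rewrite exprS mulrA ler_wpM2r ?exprn_ge0 ?addr_ge0//.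
rewrite -natr1; have := ler0n R m => m0; have := mulr_ge0 m0 (sqr_ge0 x).
by have := sqr_ge0 x; rewrite expr2; lra.
Qed.

(* The incentive constraints at [p1 = p0 (1 + 100 al)] force a loss of order
   [al], in units of [b], which the approximation guarantee at [p0] forbids. *)
Lemma no_compromise (R : realFieldType) (al e p0 ta tu tc : R) :
  0 < al -> al < 1 / 200 -> 0 < e -> 16 * e <= al -> 0 < p0 -> 8 * p0 <= 1 ->
  0 <= ta <= 1 -> 0 <= tu <= 1 -> 0 <= tc <= 1 ->
  0 <= 2 * (1 + 100 * al) * (1 / 2 * ta + 1 / 2 * tu + e) -
       (1 + 200 * al) * (1 / 2 * tc) + al -
       (1 - e) * (3 / 4 * (2 * (1 + 100 * al) * tu)) ->
  (1 - al) * (1 + (1 / 2 - e) / 2 + (1 - p0 - e) / 2) <=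
    ta + (1 / 2 - e) * tu / 2 + (1 - p0 - e) * tc / 2 + 2 * al -> False.
Proof.
move=> al0 al1 e0 eal p00 p08 /andP[a0 a1] /andP[u0 u1] /andP[c0 c1] rev gft.
set k := 1 + 100 * al in rev.
have k0 : 1 <= k by rewrite /k; lra.
have k1 : k <= 3 / 2 by rewrite /k; lra.
have ka : k * ta <= k by rewrite ler_piMr//; lra.
have ke : k * e <= 3 / 2 * e by rewrite ler_pM2r.
have ku : k * (1 - tu) <= 3 / 2 * (1 - tu) by rewrite ler_wpM2r//; lra.
have eku : k * e * tu <= 3 / 2 * e.
  apply: le_trans ke; rewrite ler_piMr// mulr_ge0//; lra.
have alc : al * (1 - tc) <= 1 / 200 * (1 - tc) by rewrite ler_wpM2r//; lra.
(* Full trade at the three pairs leaves a deficit of [49 * al] up to terms in [e], which cost less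
   than [al]. A unit cut of [tu] recovers [k / 2 <= 3 / 4], a unit cut of [tc] recovers
   [(1 + 200 * al) / 2 <= 1], and cutting [ta] recovers nothing. *)
have loss : 48 * al <= 3 / 4 * (1 - tu) + (1 - tc).
  by move: rev; rewrite /k; rewrite /k in ka ke ku eku; lra.
(* In the gains, lost trade weighs at least 49/200 for [tu] and 3/7 for [tc]. By [loss] more than
   [15 * al] is forgone, whereas the guarantee tolerates less than [4 * al]. *)
have eu : e * (1 - tu) <= 1 / 100 * (1 - tu) by rewrite ler_wpM2r//; lra.
have pc : (p0 + e) * (1 - tc) <= 1 / 7 * (1 - tc) by rewrite ler_wpM2r//; lra.
have ale : 0 <= al * e by rewrite mulr_ge0// ltW.
have alp : 0 <= al * p0 by rewrite mulr_ge0// ltW.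
lra.
Qed.

(** * Incompatibility of the two instances *)

Section two_instances.
Context {R : realType} (h b e p0 p1 al : R).
Context (b0 : 0 < b) (b16 : 16 * b <= h) (bh : b < h) (sh0 : 0 < 3 / 4 * h).
Context (DB0 DB1 DS : probability R R).
Context (law0 : two_point_law bh (1 - p0 - e) p0 e DB0).
Context (law1 : two_point_law bh (1 - p1 - e) p1 e DB1).
Context (lawS : two_point_law sh0 (1 / 2) (1 / 2 - e) e DS).

(** At [p0] the mechanism trading at all efficient atoms is feasible and bounds [SB] from below.
    Dividing this gains inequality and the revenue inequality at [p1] by [b] yields the hypotheses
    of [no_compromise]. *)
Lemma not_both (M : mechanism R) :
  0 < al -> al < 1 / 200 -> e * h = al * b -> p0 * h = 2 * b ->
  p1 = p0 * (1 + 100 * al) ->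
  feasible h DB1 DS M -> (1 - al) * SB h DB0 DS <= GFT DB0 DS M -> False.
Proof.
move: b0 b16 => b0' b16' al0 al1 eh ph p1E fM apx.
have [_ p00 e0 _ _] := law0.
have h0 : 0 < h by lra.
have p1h : p1 * h = 2 * (1 + 100 * al) * b by rewrite p1E mulrAC ph; ring.
have bp1 : b <= p1 * h.
  have := mulr_gt0 al0 b0'; lra.
have rev := feasible_revenue b0 b16 law1 lawS bp1 fM.
have phb : p0 * h <= 2 * b by lra.
have opt := le_SB b0 b16 law0 lawS (threshold_feasible_high b0 b16 law0 lawS phb).
have gM := GFT_le b0 b16 law0 lawS M.
have g1 := threshold_GFT b0 b16 law0 lawS true.
have al1' : 0 <= 1 - al by lra.
have := ler_wpM2l al1' (le_trans g1 opt) => {opt g1} g1.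
have {apx gM} gft := le_trans g1 (le_trans apx gM).
have e16 : 16 * e <= al.
  rewrite -(ler_pM2r h0) -mulrA eh; have := ler_wpM2l (ltW al0) b16'; lra.
have p8 : 8 * p0 <= 1 by rewrite -(ler_pM2r h0) -mulrA ph; lra.
apply: (no_compromise al0 al1 e0 e16 p00 p8 (trade_prob M (h, 0))
  (trade_prob M (h, 3 / 4 * h)) (trade_prob M (b, 0))).
- rewrite -(pmulr_lge0 _ b0'); move: rev; rewrite p1h eh.
  move=> rev; apply: (le_trans rev).
  rewrite le_eqVlt; apply/orP; left; apply/eqP.
  move: (trade M _) (trade M _) (trade M _) => tc tu ta.
  rewrite (_ : 3 / 4 * h * (p1 * tu) = 3 / 4 * (p1 * h) * tu); last by ring.
  by rewrite p1h; ring.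
- rewrite -(ler_pM2r b0'); move: gft.
  move: (trade M _) (trade M _) (trade M _) => tc tu ta.
  have -> : p0 * (1 / 2 * (ta * h) + (1 / 2 - e) * (tu * (h / 4))) =
      p0 * h * (1 / 2 * ta + (1 / 2 - e) * tu / 4) by field.
  have -> : p0 * (1 / 2 * h + (1 / 2 - e) * (h / 4)) =
      p0 * h * (1 / 2 + (1 / 2 - e) / 4) by field.
  by rewrite ph -[2 * e * h]mulrA eh; lra.
Qed.

End two_instances.

(** With [p * h] between [2 * b] and [3 * b], the low threshold mechanism already gains
    [p * h / 2 >= b], while no mechanism exceeds [6 * b]; hence [SB] has the order of
    [v = 16 * b]. *)
Lemma SB_range (R : realType) (h b e p al : R) (bh : b < h)
    (sh0 : 0 < 3 / 4 * h) (DB DS : probability R R) :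
  0 < b -> 16 * b <= h -> al < 1 -> e * h = al * b ->
  2 * b <= p * h <= 3 * b ->
  two_point_law bh (1 - p - e) p e DB ->
  two_point_law sh0 (1 / 2) (1 / 2 - e) e DS ->
  1 / 32 * (16 * b) <= SB h DB DS <= 16 * b.
Proof.
move=> b0 b16 al1 eh /andP[pl pu] law lawS.
have low : feasible h DB DS (threshold_mechanism h b (3 / 4 * h) false).
  exact: threshold_feasible_low.
have := le_SB b0 b16 law lawS low.
have := threshold_GFT b0 b16 law lawS false.
have := SB_ub b0 b16 law lawS.
have [a0 _ _ _ _] := law.
have : 0 < (1 - p - e) * (1 / 2 * b) by rewrite !mulr_gt0//; lra.
have : al * b < b by rewrite gtr_pMl.
move: (SB _ _ _) (GFT _ _ _) => sb gft.
rewrite -[2 * e * h]mulrA eh => H1 H2 H3 H4 H5; apply/andP; split; lra.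
Qed.

(* Le Cam's two-point method, with the second-moment domination in place of a
   total variation bound. *)
Lemma two_point_test (R : realType) d (T : measurableType d) (K : R)
    (mu0 mu1 : probability T R) (E0 E1 : set T) :
  0 <= K -> dominates2 K mu1 mu0 -> measurable E0 -> measurable E1 ->
  E0 `<=` ~` E1 -> ((2 / 3)%:E <= mu0 E0)%E -> ((2 / 3)%:E <= mu1 E1)%E ->
  4 / 3 <= K.
Proof.
move=> K0 dom mE0 mE1 disj PE0 PE1.
have bound := dominates2_event mE1 dom.
have le01 : (mu0 E0 <= 1 - mu0 E1)%E.
  rewrite -probability_setC//; apply: le_measure => //; rewrite inE//.
  exact: measurableC.
have fin (mu : probability T R) : exists y, mu E1 = y%:E.
  by exists (fine (mu E1)); rewrite fineK//; exact: fin_num_measure.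
have [y0 m0E] := fin mu0; have [y1 m1E] := fin mu1.
have := le_trans PE0 le01; rewrite m0E -EFinB lee_fin => y0ub.
move: PE1 bound; rewrite m1E m0E -!EFinM !lee_fin => y1lb bound.
(* The chain is [4 / 9 <= mu1(E1)^2 <= K * mu0(E1) <= K / 3]. *)
have sq : 2 / 3 * (2 / 3) <= y1 * y1 by apply: ler_pM => //; lra.
have y0ub' : y0 <= 1 / 3 by lra.
by have := ler_wpM2l K0 y0ub'; lra.
Qed.

(** A relative change [100 * al] of an atom of mass only [p0] has chi-square divergence of order
    [p0 * al ^+ 2]. The small factor [p0], proportional to [v / h], is the source of [h / v] in the
    sample bound. *)
Lemma chi2_le (R : realFieldType) (e p0 p1 al : R) :
  0 < e -> 0 < p0 -> 2 * p0 + e < 1 -> p1 = p0 * (1 + 100 * al) ->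
  (1 - p1 - e) ^+ 2 / (1 - p0 - e) + p1 ^+ 2 / p0 + e <=
    1 + (100 * al) ^+ 2 * (2 * p0).
Proof.
move=> e0 p00 pe p1E; have q0 : 0 < 1 - p0 - e by lra.
have -> : (1 - p1 - e) ^+ 2 / (1 - p0 - e) + p1 ^+ 2 / p0 + e =
    1 + (100 * al) ^+ 2 * (p0 * (p0 / (1 - p0 - e)) + p0).
  by rewrite p1E; field; rewrite !gt_eqF.
rewrite lerD2l ler_wpM2l ?sqr_ge0//.
have : p0 / (1 - p0 - e) <= 1 by rewrite ler_pdivrMr//; lra.
by move=> /(ler_wpM2l (ltW p00)); lra.
Qed.

(** From [b / h <= 1 / 16] and [al < 1 / 200] come [e <= 1 / 3200], [p0 <= 1 / 8] and
    [p1 <= 3 / 16], which keeps all weights positive. *)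
Lemma hard_parameters (R : realFieldType) (al b h : R) :
  0 < al -> al < 1 / 200 -> 0 < b -> 16 * b <= h -> exists e p0 p1 : R,
  [/\ [/\ 0 < e, e < 1 / 2, 0 < p0 & 0 < p1],
      [/\ 0 < 1 - p0 - e, 0 < 1 - p1 - e & 2 * p0 + e < 1],
      [/\ e * h = al * b, p0 = 2 * b / h, p0 * h = 2 * b &
          p1 = p0 * (1 + 100 * al)],
      2 * b <= p0 * h <= 3 * b & 2 * b <= p1 * h <= 3 * b].
Proof.
move=> al0 al1 b0 b16; have h0 : 0 < h by lra.
exists (al * b / h), (2 * b / h), (2 * b / h * (1 + 100 * al)).
have hN0 : h != 0 by rewrite gt_eqF.
have eh : al * b / h * h = al * b by rewrite divfK.
have ph : 2 * b / h * h = 2 * b by rewrite divfK.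
have p1h : 2 * b / h * (1 + 100 * al) * h = 2 * (1 + 100 * al) * b.
  by rewrite mulrAC ph; ring.
have alb : 0 < al * b by exact: mulr_gt0.
have alb1 : al * b <= 1 / 200 * b by rewrite ler_pM2r// ltW.
have e0 : 0 < al * b / h by rewrite divr_gt0.
have p00 : 0 < 2 * b / h by rewrite divr_gt0//; lra.
have p10 : 0 < 2 * b / h * (1 + 100 * al) by rewrite mulr_gt0//; lra.
have e1 : al * b / h <= 1 / 3200 by rewrite -(ler_pM2r h0) eh; lra.
have p0s : 2 * b / h <= 1 / 8 by rewrite -(ler_pM2r h0) ph; lra.
have p1s : 2 * b / h * (1 + 100 * al) <= 3 / 16.
  by rewrite -(ler_pM2r h0) p1h; lra.
move: (al * b / h) (2 * b / h * (1 + 100 * al)) (2 * b / h)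
  eh ph p1h e0 p00 p10 e1 p0s p1s.
move=> e p1 p0 eh ph p1h e0 p00 p10 e1 p0s p1s.
split; [by split => //; lra|by split; lra|by split| |].
- by rewrite ph; apply/andP; split; lra.
- by rewrite p1h; apply/andP; split; lra.
Qed.

(** Since [SB] varies with the instance, success is demanded only where [SB] lies between
    [kappa * v] and [v], so that [h / v] is [h / SB] up to a constant. The three constants are
    chosen before all other data, hence universal. *)
Theorem theorem4p4 (R : realType) :
  exists alpha0 c kappa : R,
    [/\ 0 < alpha0, 0 < c & 0 < kappa] /\
    forall (alpha h v : R) (m : nat) (d : measure_display)
      (S : measurableType d) (P : probability S R) (L : learner R S m),
      0 < alpha < alpha0 -> 0 < h -> 0 < v <= h ->
      (forall DB DS : probability R R, regular_instance h DB DS ->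
         kappa * v <= SB h DB DS <= v -> learns P L h alpha DB DS) ->
      c * (h / v) * (1 / alpha ^+ 2) <= m%:R.
Proof.
(* With [p0 = v / (8 h)] each buyer sample contributes an excess of at most
   [x = (100 alpha)^2 v / (4 h)]; the value of [c] makes [m x < 1 / 4] whenever the claimed bound
   fails. *)
exists (1 / 200), ((1 / 100) ^+ 2), (1 / 32); split.
  by split; [lra|rewrite exprn_gt0//; lra|lra].
move=> al h v m d S P L /andP[al0 al1] h0 /andP[v0 vh] learn.
have [b vE] : exists b, v = 16 * b by exists (v / 16); field.
subst v; have b0 : 0 < b by rewrite pmulr_rgt0 in v0.
have [e [p0 [p1 [[e0 e2 p00 p10] [q0 q1 pe] [eh p0E ph p1E] r0 r1]]]] :=
  hard_parameters al0 al1 b0 vh.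
have bh : b < h by move: b0 vh {learn}; lra.
have sh0 : 0 < 3 / 4 * h by rewrite mulr_gt0// divr_gt0.
have [DB0 law0] : exists mu, two_point_law bh (1 - p0 - e) p0 e mu.
  by apply: two_point_law_exists => //; ring.
have [DB1 law1] : exists mu, two_point_law bh (1 - p1 - e) p1 e mu.
  by apply: two_point_law_exists => //; ring.
have [DS lawS] : exists mu, two_point_law sh0 (1 / 2) (1 / 2 - e) e mu.
  by apply: two_point_law_exists; rewrite ?subr_gt0 ?divr_gt0//; field.
have regular p DB : two_point_law bh (1 - p - e) p e DB ->
    regular_instance h DB DS.
  move=> law; split.
    by apply: (two_point_buyer_regular law) => //; exact: ltW.
  apply: (two_point_seller_regular lawS) => //.
  by rewrite ler_piMl ?(ltW h0)// ler_pdivrMr// mul1r ler_nat.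
have al1' : al < 1 by clear - al1; lra.
have [E0 [mE0 PE0 E0P]] := learn _ _ (regular _ _ law0)
  (SB_range b0 vh al1' eh r0 law0 lawS).
have [E1 [mE1 PE1 E1P]] := learn _ _ (regular _ _ law1)
  (SB_range b0 vh al1' eh r1 law1 lawS).
(* An outcome [w] fixes seed and samples, hence one and the same mechanism under both instances. *)
have disj : E0 `<=` ~` E1.
  move=> w /E0P [_ apx] /E1P [fM _].
  exact: (not_both b0 vh law0 law1 lawS al0 al1 eh ph p1E fM apx).
pose C := (1 - p1 - e) ^+ 2 / (1 - p0 - e) + p1 ^+ 2 / p0 + e.
have C0 : 0 <= C.
  by rewrite !addr_ge0 ?divr_ge0 ?sqr_ge0//; exact: ltW.
(* The factors belong to the seed, the buyer samples and the seller samples; seed and seller have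
   the same law in both instances. *)
have Cm : 4 / 3 <= 1 * (C ^+ m * 1).
  apply: (two_point_test _ _ mE0 mE1 disj PE0 PE1).
    by rewrite mul1r mulr1 exprn_ge0.
  apply: dominates2_prod; [by []|by rewrite mulr1 exprn_ge0|
    exact: dominates2_refl|].
  apply: dominates2_prod; [exact: exprn_ge0|by []| |exact: dominates2_refl].
  by apply: dominates2_iid => //; exact: (two_point_dominates2 law1 law0).
rewrite mul1r mulr1 in Cm.
have CE : C <= 1 + (100 * al) ^+ 2 * (2 * p0) := chi2_le e0 p00 pe p1E.
have x0 : 0 < (100 * al) ^+ 2 * (2 * p0) by rewrite !mulr_gt0// exprn_gt0// mulr_gt0.
clear - Cm CE x0 C0 p0E b0 al0 h0.
rewrite leNgt; apply/negP => m_small.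
have mx : m%:R * ((100 * al) ^+ 2 * (2 * p0)) < 1 / 4.
  have -> : 1 / 4 = (1 / 100) ^+ 2 * (h / (16 * b)) * (1 / al ^+ 2) *
      ((100 * al) ^+ 2 * (2 * p0)).
    by rewrite p0E; field; rewrite !gt_eqF.
  by rewrite ltr_pM2r.
move: ((100 * al) ^+ 2 * (2 * p0)) x0 mx CE => x x0 mx CE.
have Cmx : C ^+ m <= (1 + x) ^+ m.
  by apply: lerXn2r => //; rewrite nnegrE// addr_ge0// ltW.
(* As [m x < 1 / 4], the product [(1 - m x) * (4 / 3)] exceeds 1, contradicting this bound. *)
have := pow1Dn_le m (ltW x0).
have : (1 - m%:R * x) * (4 / 3) <= (1 - m%:R * x) * (1 + x) ^+ m.
  by rewrite ler_pM2l; [exact: le_trans Cm Cmx|lra].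
lra.
Qed.
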